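(* Let $(\mathcal{M},d)$ be an infinite separable pointed ultrametric space. Then for every $0<p\le 1$ the Lipschitz free $p$-space $\mathcal{F}_p(\mathcal{M},d)$ is (linearly) isomorphic to $\ell_p$.
   Context: All vector spaces are real. An ultrametric on $\mathcal M$ is a metric $d$ with $d(x,z)\le\max\{d(x,y),d(y,z)\}$ for all $x,y,z$. For $0<p\le 1$, a $p$-metric on a set $\mathcal{M}$ is a symmetric map $\rho\colon\mathcal M\times\mathcal M\to[0,\infty)$ with $\rho(x,y)=0$ iff $x=y$ and $\rho(x,y)^p\le\rho(x,z)^p+\rho(z,y)^p$ for all $x,y,z$ (every metric, in particular every ultrametric, is a $p$-metric). A pointed space has a distinguished point $0$. A $p$-norm on a vector space $Y$ is a map $\|\cdot\|_Y\colon Y\to[0,\infty)$, vanishing only at $0$, with $\|\alpha y\|_Y=|\alpha|\|y\|_Y$ and $\|y+z\|_Y^p\le\|y\|_Y^p+\|z\|_Y^p$. A map $f\colon\mathcal M\to Y$ is $1$-Lipschitz if $\|f(x)-f(y)\|_Y\le\rho(x,y)$ for all $x,y$. Let $(\mathcal M,\rho)$ be a pointed $p$-metric space, let $\mathbb R_0^{\mathcal M}$ be the space of all functions $f\colon\mathcal M\to\mathbb R$ with $f(0)=0$, let $\delta(x)$ be the linear functional on $\mathbb R_0^{\mathcal M}$ given by $\langle\delta(x),f\rangle=f(x)$, and let $\mathcal P(\mathcal M)$ be the linear span of $\{\delta(x)\colon x\in\mathcal M\}$. For $\mu=\sum_{j=1}^N a_j\delta(x_j)\in\mathcal P(\mathcal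 M)$ put $$\|\mu\|_{\mathcal F_p(\mathcal M)}=\sup\Big\|\sum_{j=1}^N a_jf(x_j)\Big\|_Y,$$ the supremum being over all $p$-normed spaces $Y$ and all $1$-Lipschitz maps $f\colon\mathcal M\to Y$ with $f(0)=0$. This is a $p$-norm on $\mathcal P(\mathcal M)$, and the Lipschitz free $p$-space $\mathcal F_p(\mathcal M)$ is the completion of $\mathcal P(\mathcal M)$ with respect to it. *)

(* Defs.v *)
From HB Require Import structures.
From mathcomp Require Import all_boot all_order all_algebra.
From mathcomp Require Import generic_quotient.
From mathcomp Require Import all_classical all_reals all_analysis.
From mathcomp Require Import lra.

Set Implicit Arguments.
Unset Strict Implicit.
Unset Printing Implicit Defensive.

Import Order.TTheory GRing.Theory Num.Theory.
Import numFieldNormedType.Exports.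

Local Open Scope classical_set_scope.
Local Open Scope ring_scope.

Definition separable (T : topologicalType) : Prop :=
  exists2 D : set T, countable D & dense D.

Definition ultrametric (R : realType) (M : metricType R) : Prop :=
  forall x y z : M, mdist x z <= Num.max (mdist x y) (mdist y z).

Record is_pnorm (R : realType) (p : R) (V : lmodType R) (N : V -> R) : Prop :=
  IsPNorm {
    is_pnorm_exponent : 0 < p <= 1;
    is_pnorm_ge0 : forall v, 0 <= N v;
    is_pnorm_eq0 : forall v, N v = 0 -> v = 0;
    is_pnormZ : forall a v, N (a *: v) = `|a| * N v;
    is_pnormD : forall v w, N (v + w) `^ p <= N v `^ p + N w `^ p
  }.

Record pnormed (R : realType) (p : R) := PNormed {
  pn_sort :> lmodType R;
  pnorm : pn_sort -> R;
  pnormP : is_pnorm p pnorm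
}.
Arguments pnorm {R p} _ _.
Arguments pnormP {R p} _.

Definition linearly_isomorphic (R : realType) (p q : R) (X : pnormed p) (Y : pnormed q) :
    Prop :=
  exists (T : {linear X -> Y}) (S : {linear Y -> X}) (C : R),
    [/\ cancel T S, cancel S T,
        forall x, pnorm Y (T x) <= C * pnorm X x &
        forall y, pnorm X (S y) <= C * pnorm Y y].

Section powR_facts.
Context {R : realType}.
Implicit Types (a b p : R).

Lemma ler_powR_id p t : 0 < p <= 1 -> 0 <= t <= 1 -> t <= t `^ p.
Proof.
move=> /andP[p0 p1] /andP[]; rewrite le_eqVlt => /predU1P[<- _|t0 t1].
  by rewrite powR_ge0.
by rewrite ger1_powR// t0.
Qed.

Lemma powR_subadd p a b : 0 < p <= 1 -> 0 <= a -> 0 <= b ->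
  (a + b) `^ p <= a `^ p + b `^ p.
Proof.
move=> p01 a0 b0; have [p0 p1] := andP p01.
have [ab0|] := eqVneq (a + b) 0.
  by rewrite ab0 powR0 ?gt_eqF// addr_ge0// powR_ge0.
rewrite neq_lt ltNge addr_ge0//= => s0.
set s := a + b in s0 *.
have aE : a = s * (a / s) by rewrite mulrC divfK// gt_eqF.
have bE : b = s * (b / s) by rewrite mulrC divfK// gt_eqF.
have as0 : 0 <= a / s by rewrite divr_ge0// ltW.
have bs0 : 0 <= b / s by rewrite divr_ge0// ltW.
have ab1 : a / s + b / s = 1 by rewrite -mulrDl divff// gt_eqF.
have ta : a / s <= (a / s) `^ p by rewrite ler_powR_id// as0/=; lra.
have tb : b / s <= (b / s) `^ p by rewrite ler_powR_id// bs0/=; lra.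
have -> : a `^ p = s `^ p * (a / s) `^ p by rewrite -powRM// -?aE// ltW.
have -> : b `^ p = s `^ p * (b / s) `^ p by rewrite -powRM// -?bE// ltW.
by rewrite -mulrDr ler_peMr ?powR_ge0// -ab1 lerD.
Qed.

Lemma ler_powRE p a b : 0 < p -> 0 <= a -> 0 <= b ->
  (a `^ p <= b `^ p) = (a <= b).
Proof.
move=> p0 a0 b0; apply/idP/idP => [|ab].
  by apply: contraTT; rewrite -!ltNge => ab; rewrite gt0_ltr_powR.
by rewrite ge0_ler_powR// ltW.
Qed.

Lemma ltr_powRE p a b : 0 < p -> 0 <= a -> 0 <= b ->
  (a `^ p < b `^ p) = (a < b).
Proof. by move=> p0 a0 b0; rewrite !ltNge ler_powRE. Qed.

Lemma powRVK p a : 0 < p -> 0 <= a -> (a `^ p^-1) `^ p = a.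
Proof. by move=> p0 a0; rewrite -powRrM mulVf ?gt_eqF// powRr1. Qed.

Lemma powRKV p a : 0 < p -> 0 <= a -> (a `^ p) `^ p^-1 = a.
Proof. by move=> p0 a0; rewrite -powRrM mulfV ?gt_eqF// powRr1. Qed.

Lemma cvg_powR_root p (w : nat -> R) (l : R) : 0 < p -> (forall n, 0 <= w n) -> 0 <= l ->
  (w n `^ p @[n --> \oo] --> l) -> (w n @[n --> \oo] --> l `^ p^-1).
Proof.
move=> p0 w0 l0 wl; apply/cvgrPdist_lt => e e0.
set L := l `^ p^-1; have L0 : 0 <= L by exact: powR_ge0.
have lE : l = L `^ p by rewrite powRVK.
have up : \forall n \near \oo, w n < L + e.
  have lt : l < (L + e) `^ p.
    by rewrite [ltLHS]lE ltr_powRE// ?ltrDl// addr_ge0// ltW.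
  near=> n; rewrite -(ltr_powRE p0)//; last by rewrite addr_ge0// ltW.
  by near: n; exact: cvgr_lt wl _ lt.
have dn : \forall n \near \oo, L - e < w n.
  have [Le|Le] := ltP (L - e) 0.
    by apply: nearW => n; exact: lt_le_trans Le _.
  have lt : (L - e) `^ p < l by rewrite [ltRHS]lE ltr_powRE// ltrBlDr ltrDl.
  near=> n; rewrite -(ltr_powRE p0)//.
  by near: n; exact: cvgr_gt wl _ lt.
near=> n; rewrite ltr_distlC; apply/andP; split.
  by near: n.
by near: n.
Unshelve. all: by end_near. Qed.

End powR_facts.

Section pnormed_facts.
Context {R : realType} {p : R} (X : pnormed p).
Implicit Types (v w : X).

Lemma pn_exp01 : 0 < p <= 1. Proof. by case: (pnormP X). Qed.
Lemma pn_exp0 : 0 < p. Proof. by have /andP[] := pn_exp01. Qed.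
Lemma pnorm_ge0 v : 0 <= pnorm X v. Proof. exact: is_pnorm_ge0 (pnormP X) v. Qed.
Lemma pnorm_eq0 v : pnorm X v = 0 -> v = 0.
Proof. exact: is_pnorm_eq0 (pnormP X) v. Qed.
Lemma pnormZ a v : pnorm X (a *: v) = `|a| * pnorm X v.
Proof. exact: is_pnormZ (pnormP X) a v. Qed.
Lemma pnormD v w : pnorm X (v + w) `^ p <= pnorm X v `^ p + pnorm X w `^ p.
Proof. exact: is_pnormD (pnormP X) v w. Qed.

Lemma pnorm0 : pnorm X 0 = 0.
Proof. by rewrite -(scale0r 0) pnormZ normr0 mul0r. Qed.

Lemma pnormN v : pnorm X (- v) = pnorm X v.
Proof. by rewrite -scaleN1r pnormZ normrN1 mul1r. Qed.

Lemma pnormB v w : pnorm X (v - w) = pnorm X (w - v).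
Proof. by rewrite -pnormN opprB. Qed.

Lemma pnorm_sum (I : Type) (r : seq I) (F : I -> X) :
  pnorm X (\sum_(i <- r) F i) `^ p <= \sum_(i <- r) pnorm X (F i) `^ p.
Proof.
elim/big_rec2: _ => [|i y x _ le]; first by rewrite pnorm0 powR0// gt_eqF// pn_exp0.
by rewrite (le_trans (pnormD _ _))// lerD2l.
Qed.

Lemma pnorm_dist v w :
  `|pnorm X v `^ p - pnorm X w `^ p| <= pnorm X (v - w) `^ p.
Proof.
rewrite ler_norml; apply/andP; split.
  by have := pnormD (w - v) v; rewrite subrK pnormB; lra.
by have := pnormD (v - w) w; rewrite subrK; lra.
Qed.

End pnormed_facts.

Section completion.
Context {R : realType} {p : R} (X : pnormed p).

Definition pcauchy (u : nat -> X) : Prop :=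
  forall e, 0 < e -> exists k, forall m n, (k <= m)%N -> (k <= n)%N ->
    pnorm X (u m - u n) < e.

Definition pcauchy_pred : {pred nat -> X} := fun u => `[< pcauchy u >].

Let half_pow (e : R) : 0 < e -> 0 < (e `^ p / 2) `^ p^-1.
Proof. by move=> e0; rewrite powR_gt0// divr_gt0// powR_gt0. Qed.

Let lt_half_pow (e x y : R) : 0 < e -> 0 <= x -> 0 <= y ->
  x < (e `^ p / 2) `^ p^-1 -> y < (e `^ p / 2) `^ p^-1 -> x `^ p + y `^ p < e `^ p.
Proof.
have p0 := pn_exp0 X.
have half t : 0 < e -> 0 <= t -> t < (e `^ p / 2) `^ p^-1 -> t `^ p < e `^ p / 2.
  move=> e0 t0; rewrite -(ltr_powRE p0)// ?powR_ge0// powRVK//.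
  by rewrite divr_ge0// powR_ge0.
by move=> e0 x0 y0 /(half _ e0 x0) ? /(half _ e0 y0) ?; lra.
Qed.

Lemma pcauchyD u v : pcauchy u -> pcauchy v -> pcauchy (u + v).
Proof.
move=> cu cv e e0; have [k1 h1] := cu _ (half_pow e0).
have [k2 h2] := cv _ (half_pow e0).
exists (maxn k1 k2) => m n; rewrite !geq_max => /andP[m1 m2] /andP[n1 n2].
rewrite -(ltr_powRE (pn_exp0 X)) ?pnorm_ge0 ?ltW//.
rewrite (_ : _ - _ = (u m - u n) + (v m - v n)); last first.
  by rewrite addrfctE opprD addrACA.
by rewrite (le_lt_trans (pnormD _ _))// lt_half_pow ?pnorm_ge0 ?h1 ?h2.
Qed.

Lemma pcauchyZ a u : pcauchy u -> pcauchy (a *: u).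
Proof.
move=> cu e e0; have a0 : 0 < `|a| + 1 by rewrite ltr_wpDl.
have [k h] := cu _ (divr_gt0 e0 a0); exists k => m n km kn.
rewrite (_ : _ - _ = a *: (u m - u n)); last by rewrite scalerBr.
rewrite pnormZ (@le_lt_trans _ _ ((`|a| + 1) * pnorm X (u m - u n)))//.
  by rewrite ler_wpM2r ?pnorm_ge0// lerDl.
by rewrite mulrC -ltr_pdivlMr// h.
Qed.

Lemma pcauchy_cst x : pcauchy (fun=> x).
Proof. by move=> e e0; exists 0%N => m n _ _; rewrite subrr pnorm0. Qed.

Lemma pcauchy_submod_closed : submod_closed pcauchy_pred.
Proof.
split; first exact/asboolP/pcauchy_cst.
move=> a u v /asboolP cu /asboolP cv; apply/asboolP.
by apply: pcauchyD => //; exact: pcauchyZ.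
Qed.

HB.instance Definition _ :=
  GRing.isSubmodClosed.Build R (nat -> X) pcauchy_pred pcauchy_submod_closed.

Record cauchy_seq := CauchySeq {
  cauchy_val :> nat -> X;
  _ : cauchy_val \in pcauchy_pred }.

HB.instance Definition _ := [isSub for cauchy_val].
HB.instance Definition _ := [Choice of cauchy_seq by <:].
HB.instance Definition _ := [SubChoice_isSubLmodule of cauchy_seq by <:].

Lemma cauchy_seqP (u : cauchy_seq) : pcauchy u.
Proof. by apply/asboolP; exact: (valP u). Qed.

Definition null_seq (u : nat -> X) : Prop := pnorm X (u n) @[n --> \oo] --> (0 : R).

Lemma null_seqP u : null_seq u <->
  forall e, 0 < e -> exists k, forall n, (k <= n)%N -> pnorm X (u n) < e.
Proof.
split=> [/cvgrPdist_lt h e e0|h].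
  have [k _ hk] := h e e0; exists k => n kn; have := hk n kn.
  by rewrite sub0r normrN ger0_norm// pnorm_ge0.
apply/cvgrPdist_lt => e e0; have [k hk] := h e e0; exists k => // n kn.
by rewrite sub0r normrN ger0_norm ?pnorm_ge0//; exact: hk.
Qed.

Lemma null_pcauchy u : null_seq u -> pcauchy u.
Proof.
move=> /null_seqP h e e0; have [k hk] := h _ (half_pow e0).
exists k => m n km kn; rewrite -(ltr_powRE (pn_exp0 X)) ?pnorm_ge0 ?ltW//.
by rewrite (le_lt_trans (pnormD _ _))// pnormN lt_half_pow ?pnorm_ge0 ?hk.
Qed.

Lemma null_seq0 : null_seq 0.
Proof. by apply/null_seqP => e e0; exists 0%N => n _; rewrite pnorm0. Qed.

Lemma null_seqD u v : null_seq u -> null_seq v -> null_seq (u + v).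
Proof.
move=> /null_seqP cu /null_seqP cv; apply/null_seqP => e e0.
have [k1 h1] := cu _ (half_pow e0); have [k2 h2] := cv _ (half_pow e0).
exists (maxn k1 k2) => n; rewrite !geq_max => /andP[n1 n2].
rewrite -(ltr_powRE (pn_exp0 X)) ?pnorm_ge0 ?ltW//.
by rewrite (le_lt_trans (pnormD _ _))// lt_half_pow ?pnorm_ge0 ?h1 ?h2.
Qed.

Lemma null_seqZ a u : null_seq u -> null_seq (a *: u).
Proof.
move=> cu; rewrite /null_seq; rewrite -(mulr0 `|a|).
under eq_cvg do rewrite pnormZ.
by apply: cvgM => //; exact: cvg_cst.
Qed.

Definition cauchy_equiv : rel cauchy_seq :=
  fun u v => `[< null_seq (u - v : cauchy_seq) >].

Lemma cauchy_equiv_is_equiv : equiv_class_of cauchy_equiv.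
Proof.
split.
- by move=> u; apply/asboolP; rewrite subrr; exact: null_seq0.
- move=> u v; apply/asboolP/asboolP => h.
  + by rewrite -opprB -scaleN1r; exact: null_seqZ.
  + by rewrite -opprB -scaleN1r; exact: null_seqZ.
- move=> v u w /asboolP uv /asboolP vw; apply/asboolP.
  by rewrite -(subrKA v); exact: null_seqD.
Qed.

Canonical cauchy_equiv_canonical := EquivRelPack cauchy_equiv_is_equiv.

Local Open Scope quotient_scope.

Definition completion : Type := {eq_quot cauchy_equiv}.
HB.instance Definition _ := Choice.on completion.
HB.instance Definition _ := EqQuotient.on completion.

Lemma completion_eqP (u v : cauchy_seq) :
  \pi_completion u = \pi_completion v <-> null_seq (u - v : cauchy_seq).
Proof. by split=> [/eqquotP/asboolP//|h]; apply/eqquotP/asboolP. Qed.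

Lemma repr_equiv (u : cauchy_seq) :
  null_seq (repr (\pi_completion u) - u : cauchy_seq).
Proof. by apply/completion_eqP; rewrite reprK. Qed.

Definition completion_zero : completion := \pi_completion 0.
Definition completion_opp (x : completion) : completion := \pi_completion (- repr x).
Definition completion_add (x y : completion) : completion :=
  \pi_completion (repr x + repr y).
Definition completion_scale (a : R) (x : completion) : completion :=
  \pi_completion (a *: repr x).

Lemma completion_addE (u v : cauchy_seq) :
  completion_add (\pi_completion u) (\pi_completion v) = \pi_completion (u + v).
Proof.
apply/completion_eqP; rewrite opprD addrACA.
by apply: null_seqD; exact: repr_equiv.
Qed.

Lemma completion_scaleE a (u : cauchy_seq) :
  completion_scale a (\pi_completion u) = \pi_completion (a *: u).
Proof.
by apply/completion_eqP; rewrite -scalerBr; apply: null_seqZ; exact: repr_equiv.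
Qed.

Lemma completion_oppE (u : cauchy_seq) :
  completion_opp (\pi_completion u) = \pi_completion (- u).
Proof.
by rewrite -scaleN1r -completion_scaleE/completion_scale scaleN1r.
Qed.

Lemma completion_ind (P : completion -> Prop) :
  (forall u : cauchy_seq, P (\pi_completion u)) -> forall x, P x.
Proof. by move=> h x; rewrite -(reprK x). Qed.

Lemma completion_addA : associative completion_add.
Proof.
elim/completion_ind => u; elim/completion_ind => v; elim/completion_ind => w.
by rewrite !completion_addE addrA.
Qed.

Lemma completion_addC : commutative completion_add.
Proof.
by elim/completion_ind => u; elim/completion_ind => v; rewrite !completion_addE addrC.
Qed.

Lemma completion_add0 : left_id completion_zero completion_add.
Proof. by elim/completion_ind => u; rewrite completion_addE add0r. Qed.

Lemma completion_addN : left_inverse completion_zero completion_opp completion_add.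
Proof.
by elim/completion_ind => u; rewrite completion_oppE completion_addE addNr.
Qed.

HB.instance Definition _ := GRing.isZmodule.Build completion
  completion_addA completion_addC completion_add0 completion_addN.

Lemma completion_piD (u v : cauchy_seq) :
  \pi_completion u + \pi_completion v = \pi_completion (u + v).
Proof. exact: completion_addE. Qed.

Lemma completion_scaleA a b x :
  completion_scale a (completion_scale b x) = completion_scale (a * b) x.
Proof.
by elim/completion_ind: x => u; rewrite !completion_scaleE scalerA.
Qed.

Lemma completion_scale1 : left_id 1 completion_scale.
Proof. by elim/completion_ind => u; rewrite completion_scaleE scale1r. Qed.

Lemma completion_scaleDr : right_distributive completion_scale +%R.
Proof.
move=> a; elim/completion_ind => u; elim/completion_ind => v.
by rewrite completion_piD !completion_scaleE completion_piD scalerDr.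
Qed.

Lemma completion_scaleDl x : {morph completion_scale^~ x : a b / a + b}.
Proof.
move=> a b; elim/completion_ind: x => u.
by rewrite !completion_scaleE completion_piD scalerDl.
Qed.

HB.instance Definition _ := GRing.Zmodule_isLmodule.Build R completion
  completion_scaleA completion_scale1 completion_scaleDr completion_scaleDl.

Lemma completion_piZ a (u : cauchy_seq) :
  a *: \pi_completion u = \pi_completion (a *: u).
Proof. exact: completion_scaleE. Qed.

Definition completion_norm (x : completion) : R :=
  limn (fun n => pnorm X (repr x n)).

Lemma pcauchy_cvg u : pcauchy u -> exists2 l : R, 0 <= l &
  (pnorm X (u n) `^ p @[n --> \oo] --> l) /\
  (pnorm X (u n) @[n --> \oo] --> l `^ p^-1).
Proof.
have p0 := pn_exp0 X.
move=> cu; have : cvgn (fun n => pnorm X (u n) `^ p).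
  apply/cauchy_cvgP/cauchy_exP => e e0.
  have [k hk] := cu _ (powR_gt0 p^-1 e0).
  exists (pnorm X (u k) `^ p); exists k => // n kn; rewrite /ball/=.
  apply: le_lt_trans (pnorm_dist _ _) _.
  rewrite -[ltRHS](powRVK p0 (ltW e0)) ltr_powRE ?pnorm_ge0 ?powR_ge0//.
  exact: hk.
move=> /cvg_ex[/= l cl]; have l0 : 0 <= l.
  by apply: cvgr_to_ge cl _; apply: nearW => n; exact: powR_ge0.
exists l => //; split => //.
by apply: cvg_powR_root => // n; exact: pnorm_ge0.
Qed.

Lemma completion_norm_cvg (u : cauchy_seq) :
  pnorm X (u n) @[n --> \oo] --> completion_norm (\pi_completion u).
Proof.
have p0 := pn_exp0 X.
have [l l0 [lp ll]] := pcauchy_cvg (cauchy_seqP u).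
set v := repr (\pi_completion u).
have [l' l'0 [lp' ll']] := pcauchy_cvg (cauchy_seqP v).
suff e : l = l' by rewrite /completion_norm (cvg_lim _ ll')// -e.
have vu : pnorm X ((v - u : cauchy_seq) n) `^ p @[n --> \oo] --> (0 : R).
  have := repr_equiv u; rewrite -/v => /null_seqP h.
  apply/cvgrPdist_lt => e e0; have [k hk] := h _ (powR_gt0 p^-1 e0).
  exists k => // n kn; rewrite sub0r normrN ger0_norm ?powR_ge0//.
  rewrite -[ltRHS](powRVK p0 (ltW e0)) ltr_powRE ?pnorm_ge0 ?powR_ge0//.
  exact: hk.
have : (pnorm X (v n) `^ p - pnorm X (u n) `^ p) @[n --> \oo] --> (0 : R).
  apply/norm_cvg0P; apply: (squeeze_cvgr _ (cvg_cst 0) vu).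
  by apply: nearW => n; rewrite normr_ge0/= pnorm_dist.
move=> /cvg_unique => /(_ (@norm_hausdorff _ _) _ (cvgB lp' lp)).
by move/eqP; rewrite eq_sym subr_eq0 => /eqP.
Qed.

Arguments completion_norm_cvg : clear implicits.

Lemma completion_normP : is_pnorm p completion_norm.
Proof.
have p0 := pn_exp0 X.
split.
- exact: pn_exp01 X.
- elim/completion_ind => u; apply: cvgr_to_ge (completion_norm_cvg u) _.
  by apply: nearW => n; exact: pnorm_ge0.
- elim/completion_ind => u u0; have := completion_norm_cvg u; rewrite u0 => h.
  by apply/completion_eqP; rewrite subr0.
- move=> a; elim/completion_ind => u.
  rewrite completion_piZ.
  apply: (cvg_unique (@norm_hausdorff _ _) (completion_norm_cvg (a *: u))).
  rewrite (_ : (fun n => _) = (fun n => `|a| * pnorm X (u n))).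
    by apply: cvgM; [exact: cvg_cst|exact: completion_norm_cvg].
  by apply/funext => n; exact: pnormZ.
- elim/completion_ind => u; elim/completion_ind => v.
  rewrite completion_piD.
  have hp (w : cauchy_seq) :
      pnorm X (w n) `^ p @[n --> \oo] --> completion_norm (\pi_completion w) `^ p.
    have [l l0 [lp ll]] := pcauchy_cvg (cauchy_seqP w).
    rewrite (_ : completion_norm (\pi_completion w) = l `^ p^-1) ?powRVK//.
    exact: (cvg_unique (@norm_hausdorff _ _) (completion_norm_cvg w)).
  apply: ler_cvg_to (hp (u + v)) (cvgD (hp u) (hp v)) _.
  by apply: nearW => n; exact: pnormD.
Qed.

Definition pcompletion : pnormed p := PNormed completion_normP.

End completion.
Arguments pcauchy_pred {R p} X _.
Arguments completion_norm_cvg {R p} X u.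

Section completion_properties.
Context {R : realType} {p : R} (X : pnormed p).
Local Open Scope quotient_scope.

Lemma cst_cauchy_subproof (x : X) : (fun=> x) \in pcauchy_pred X.
Proof. exact/asboolP/pcauchy_cst. Qed.

Definition completion_emb (x : X) : pcompletion X :=
  \pi_(completion X) (CauchySeq (cst_cauchy_subproof x)).

Lemma completion_emb_linear : linear completion_emb.
Proof.
move=> a x y; rewrite /completion_emb completion_piZ completion_piD.
by congr (\pi_(completion X) _); apply: val_inj.
Qed.

HB.instance Definition _ := GRing.isLinear.Build R X (pcompletion X) _
  completion_emb completion_emb_linear.

Lemma pnorm_completion_emb x : pnorm (pcompletion X) (completion_emb x) = pnorm X x.
Proof.
apply: (cvg_unique (@norm_hausdorff _ _)
  (completion_norm_cvg X (CauchySeq (cst_cauchy_subproof x)))).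
by rewrite /=; exact: cvg_cst.
Qed.

Lemma completion_emb_approx (u : cauchy_seq X) e : 0 < e ->
  exists k, forall n, (k <= n)%N ->
    pnorm (pcompletion X) (\pi_(completion X) u - completion_emb (u n)) <= e.
Proof.
move=> e0; have [k hk] := cauchy_seqP u e0; exists k => n kn.
rewrite /completion_emb -scaleN1r completion_piZ completion_piD.
apply: cvgr_to_le (completion_norm_cvg X _) _.
by exists k => // m km /=; rewrite scaleN1r ltW// hk.
Qed.

Lemma completion_emb_dense (x : pcompletion X) e : 0 < e ->
  exists y, pnorm (pcompletion X) (x - completion_emb y) < e.
Proof.
elim/(@completion_ind _ _ X): x => u e0.
have e20 : 0 < e / 2 by rewrite divr_gt0.
have [k hk] := completion_emb_approx u e20; exists (u k).
by apply: le_lt_trans (hk k (leqnn _)) _; lra.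
Qed.

End completion_properties.

Lemma pcompletion_complete (R : realType) (p : R) (X : pnormed p)
    (x : nat -> pcompletion X) : pcauchy x ->
  exists l : pcompletion X, null_seq (fun n => x n - l).
Proof.
move=> cx; have p0 := pn_exp0 X.
have /choice[y hy] n : exists y,
    pnorm (pcompletion X) (x n - completion_emb y) < n.+1%:R^-1.
  by apply: completion_emb_dense; rewrite invr_gt0.
have xy0 : null_seq (fun n => completion_emb (y n) - x n).
  apply/null_seqP => e e0; have [k _ hk] := near_infty_natSinv_lt (PosNum e0).
  by exists k => n kn; rewrite pnormB (lt_trans (hy n))//; exact: hk.
have cy : pcauchy y.
  have : pcauchy (fun n => completion_emb (y n)).
    have -> : (fun n => completion_emb (y n)) =
        (fun n => completion_emb (y n) - x n) + x.
      by apply/funext => n; rewrite addrfctE subrK.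
    apply: pcauchyD => //.
    by apply: null_pcauchy.
  move=> h e e0; have [k hk] := h e e0; exists k => m n km kn.
  by have := hk m n km kn; rewrite -linearB pnorm_completion_emb.
pose u := CauchySeq (asboolT cy : y \in pcauchy_pred X).
exists (\pi_(completion X) u)%qT.
have -> : (fun n => x n - \pi_(completion X)%qT u) =
    (-1) *: (fun n => completion_emb (y n) - x n) +
    (-1) *: (fun n => \pi_(completion X)%qT u - completion_emb (y n)).
  apply/funext => n; rewrite addrfctE !scaleN1r /GRing.opp/= !opprB.
  by rewrite addrA subrK.
apply: null_seqD; first exact: null_seqZ.
apply: null_seqZ; apply/null_seqP => e e0.
have e20 : 0 < e / 2 by rewrite divr_gt0.
have [k hk] := completion_emb_approx u e20; exists k => n kn.
by apply: le_lt_trans (hk n kn) _; lra.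
Qed.

Lemma real_line_pnormP (R : realType) (p : R) (hp : 0 < p <= 1) :
  is_pnorm p (fun x : R^o => `|x| : R).
Proof.
split=> //.
- by move=> v /normr0_eq0.
- by move=> a v; rewrite normrM.
- move=> v w; apply: le_trans (powR_subadd hp (normr_ge0 v) (normr_ge0 w)).
  by rewrite ler_powRE ?ler_normD// ?addr_ge0//; case/andP: hp.
Qed.

Definition real_line (R : realType) (p : R) (hp : 0 < p <= 1) : pnormed p :=
  PNormed (real_line_pnormP hp).

Section ell.
Context {R : realType} {p : R} (hp : 0 < p <= 1).
Let p0 : 0 < p. Proof. by case/andP: hp. Qed.

Definition psummable (x : nat -> R^o) : Prop :=
  cvgn (series (fun n => `|x n| `^ p)).

(* [hp] is an argument only so that the module structure, which needs it, can
   be inferred from the predicate. *)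
Definition ell_pred of (0 < p <= 1) : {pred nat -> R^o} :=
  fun x => `[< psummable x >].

Lemma psummable0 : psummable 0.
Proof.
rewrite /psummable (_ : series _ = fun=> 0); first exact: is_cvg_cst.
apply/funext => n; rewrite /series/= big1// => i _.
by rewrite normr0 powR0// gt_eqF.
Qed.

Let scale_term a (x : nat -> R^o) : (fun n => `|(a *: x) n| `^ p) =
  `|a| `^ p *: (fun n => `|x n| `^ p : R^o).
Proof.
by apply/funext => n; rewrite !scalrfctE /GRing.scale/= normrM powRM.
Qed.

Lemma psummableZ a x : psummable x -> psummable (a *: x).
Proof.
by move=> sx; rewrite /psummable scale_term; exact: is_cvg_seriesZ.
Qed.

Let le_term (x y : nat -> R^o) n :
  `|(x + y) n| `^ p <= `|x n| `^ p + `|y n| `^ p.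
Proof. exact: is_pnormD (real_line_pnormP hp) (x n) (y n). Qed.

Lemma psummableD x y : psummable x -> psummable y -> psummable (x + y).
Proof.
move=> sx sy; apply: series_le_cvg (is_cvg_seriesD sx sy).
- by move=> n; exact: powR_ge0.
- by move=> n; rewrite addr_ge0// powR_ge0.
- by move=> n; exact: le_term.
Qed.

Lemma ell_submod_closed : submod_closed (ell_pred hp).
Proof.
split; first exact/asboolP/psummable0.
move=> a x y /asboolP sx /asboolP sy; apply/asboolP.
exact: (@psummableD (a *: x) y (@psummableZ a x sx) sy).
Qed.

HB.instance Definition _ :=
  GRing.isSubmodClosed.Build R (nat -> R^o) (ell_pred hp) ell_submod_closed.

Record ell_seq := EllSeq { ell_val :> nat -> R^o; _ : ell_val \in ell_pred hp }.

HB.instance Definition _ := [isSub for ell_val].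
HB.instance Definition _ := [Choice of ell_seq by <:].
HB.instance Definition _ := [SubChoice_isSubLmodule of ell_seq by <:].

Lemma ell_seqP (x : ell_seq) : psummable x.
Proof. by apply/asboolP; exact: (valP x). Qed.

Arguments ell_seqP : clear implicits.

Definition ell_norm (x : ell_seq) : R :=
  (limn (series (fun n => `|x n| `^ p))) `^ p^-1.

Lemma ell_series_nd (x : nat -> R^o) :
  nondecreasing_seq (series (fun n => `|x n| `^ p)).
Proof. by apply: nondecreasing_series => n _ _; exact: powR_ge0. Qed.

Lemma ell_series_ge0 (x : ell_seq) : 0 <= limn (series (fun n => `|x n| `^ p)).
Proof.
apply: limr_ge; first exact: ell_seqP.
by apply: nearW => n; rewrite /series/= sumr_ge0// => i _; exact: powR_ge0.
Qed.

Lemma ell_normE (x : ell_seq) :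
  ell_norm x `^ p = limn (series (fun n => `|x n| `^ p)).
Proof. by rewrite powRVK ?ell_series_ge0. Qed.

Lemma ell_normD (x y : ell_seq) :
  ell_norm (x + y) `^ p <= ell_norm x `^ p + ell_norm y `^ p.
Proof.
have hD := lim_seriesD (ell_seqP x) (ell_seqP y).
have le_eq (a b c a' b' c' : R) : a = a' -> b = b' -> c = c' ->
    a' <= b' + c' -> a <= b + c by move=> -> -> ->.
apply: (le_eq _ _ _ _ _ _ (ell_normE (x + y)) (ell_normE x) (ell_normE y)).
apply: (@le_trans _ _
  (limn (series ((fun n => `|x n| `^ p) + (fun n => `|y n| `^ p : R))))).
  apply: lim_series_le.
  - exact: ell_seqP (x + y).
  - exact: is_cvg_seriesD (ell_seqP x) (ell_seqP y).
  - by move=> n; exact: le_term.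
by rewrite hD.
Qed.

Lemma ell_normP : is_pnorm p ell_norm.
Proof.
split=> //.
- by move=> x; exact: powR_ge0.
- move=> x /powR_eq0_eq0 x0; apply/val_inj/funext => n.
  have := nondecreasing_cvgn_le (ell_series_nd x) (ell_seqP x) n.+1.
  rewrite x0 /series/= big_nat_recr//= => le0.
  have : `|x n| `^ p <= 0.
    by apply: le_trans le0; rewrite lerDr sumr_ge0// => i _; exact: powR_ge0.
  rewrite le_eqVlt ltNge powR_ge0 orbF => /eqP /powR_eq0_eq0.
  by move/normr0_eq0.
- move=> a x; apply: (powR_injective p0); rewrite ?nnegrE ?mulr_ge0 ?powR_ge0//.
  rewrite ell_normE powRM ?powR_ge0// ell_normE.
  have := lim_seriesZ (`|a| `^ p) (ell_seqP x).
  by rewrite -scale_term.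
- exact: ell_normD.
Qed.

Definition ell : pnormed p := PNormed ell_normP.

End ell.
Arguments ell_seqP {R p hp} x.

Section free_space.
Context {R : realType} {M : metricType R} (x0 : M).

Definition fun0 := {f : M -> R | f x0 = 0}.

(* The ambient space of all functions on [fun0], linear or not, is as good as
   the algebraic dual: the span of evaluations lies in the latter. *)
Definition delta (x : M) : fun0 -> R^o := fun f => sval f x.

Definition molecule_pred : {pred fun0 -> R^o} := fun mu =>
  `[< exists n (a : 'I_n -> R) (x : 'I_n -> M), mu = \sum_i a i *: delta (x i) >].

Lemma molecule_submod_closed : submod_closed molecule_pred.
Proof.
split.
  apply/asboolP; exists 0%N, (fun=> 0), (fun=> x0); by rewrite big_ord0.
move=> c u v /asboolP[n [a [x ->]]] /asboolP[m [b [y ->]]]; apply/asboolP.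
exists (n + m)%N, (fun i => match fintype.split i with inl j => c * a j | inr j => b j end),
  (fun i => match fintype.split i with inl j => x j | inr j => y j end).
rewrite big_split_ord/= scaler_sumr; congr (_ + _); apply: eq_bigr => i _.
  by rewrite (unsplitK (inl i)) scalerA.
by rewrite (unsplitK (inr i)).
Qed.

HB.instance Definition _ :=
  GRing.isSubmodClosed.Build R (fun0 -> R^o) molecule_pred molecule_submod_closed.

Record molecule := Molecule {
  molecule_val :> fun0 -> R^o;
  _ : molecule_val \in molecule_pred }.

HB.instance Definition _ := [isSub for molecule_val].
HB.instance Definition _ := [Choice of molecule by <:].
HB.instance Definition _ := [SubChoice_isSubLmodule of molecule by <:].

Lemma moleculeP (mu : molecule) : exists n (a : 'I_n -> R) (x : 'I_n -> M),
  mu = \sum_i a i *: delta (x i) :> (fun0 -> R^o).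
Proof. by apply/asboolP; exact: (valP mu). Qed.

Definition lipschitz1 (p : R) (Y : pnormed p) (f : M -> Y) : Prop :=
  forall x y, pnorm Y (f x - f y) <= mdist x y.

(* All representations of [mu] are allowed here; the value does not depend on
   the representation, see [free_value_rep]. The set is nonempty and bounded
   ([free_values0], [free_values_ubound]), so [sup] below is a true supremum. *)
Definition free_values (p : R) (mu : molecule) : set R :=
  [set r | exists n (a : 'I_n -> R) (x : 'I_n -> M) (Y : pnormed p) (f : M -> Y),
    [/\ mu = \sum_i a i *: delta (x i) :> (fun0 -> R^o),
        lipschitz1 f, f x0 = 0 &
        r = pnorm Y (\sum_i a i *: f (x i))]].

Definition free_norm (p : R) (mu : molecule) : R := sup (free_values p mu).

Lemma group_sum (V : lmodType R) (I : finType) (c : I -> R) (z : I -> M)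
    (f : M -> V) : f x0 = 0 ->
  (forall w, w != x0 -> \sum_(i | z i == w) c i = 0) ->
  \sum_i c i *: f (z i) = 0.
Proof.
move=> f0 c0; set s := undup [seq z i | i <- enum I].
transitivity (\sum_i \sum_(w <- s) (if z i == w then c i *: f w else 0)).
  apply: eq_bigr => i _; rewrite -big_mkcond/=.
  rewrite (eq_bigl (pred1 (z i))); last by move=> w; rewrite /= eq_sym.
  rewrite -big_filter filter_pred1_uniq ?undup_uniq ?big_seq1//.
  by rewrite mem_undup map_f// mem_enum.
rewrite exchange_big big1//= => w _; rewrite -big_mkcond/= -scaler_suml.
by have [->|wx0] := eqVneq w x0; rewrite ?f0 ?scaler0// c0// scale0r.
Qed.

Lemma delta_x0 : delta x0 = 0.
Proof. by apply/funext => -[f f0]. Qed.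

Lemma delta_coef (I : finType) (c : I -> R) (z : I -> M) :
  \sum_i c i *: delta (z i) = 0 ->
  forall w, w != x0 -> \sum_(i | z i == w) c i = 0.
Proof.
move=> e w wx0.
have h0 : (fun x => (x == w)%:R : R) x0 = 0 by rewrite eq_sym (negbTE wx0).
pose chi : fun0 := 
  exist (fun f : M -> R => f x0 = 0) (fun x => (x == w)%:R) h0.
have := congr1 (fun F => F chi) e.
rewrite fct_sumE => sum0; rewrite -[RHS]sum0 big_mkcond/=; apply: eq_bigr => i _.
rewrite scalrfctE /delta/= /GRing.scale/=.
by case: eqP => _; rewrite ?mulr1 ?mulr0.
Qed.

Lemma delta_rep (V : lmodType R) (f : M -> V) n m
    (a : 'I_n -> R) (x : 'I_n -> M) (b : 'I_m -> R) (y : 'I_m -> M) :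
  f x0 = 0 ->
  \sum_i a i *: delta (x i) = \sum_i b i *: delta (y i) ->
  \sum_i a i *: f (x i) = \sum_i b i *: f (y i).
Proof.
move=> f0 /eqP; rewrite -subr_eq0 => /eqP e; apply/eqP; rewrite -subr_eq0; apply/eqP.
pose c (i : 'I_n + 'I_m) := match i with inl j => a j | inr j => - b j end.
pose z (i : 'I_n + 'I_m) := match i with inl j => x j | inr j => y j end.
have cz (W : lmodType R) (g : M -> W) :
    \sum_i a i *: g (x i) - \sum_i b i *: g (y i) = \sum_i c i *: g (z i).
  rewrite big_sumType/= -sumrN; congr (_ + _).
  by apply: eq_bigr => i _; rewrite scaleNr.
by rewrite cz; apply: group_sum => //; apply: delta_coef; rewrite -cz.
Qed.

Lemma free_value_rep (p : R) (mu : molecule) n (a : 'I_n -> R) (x : 'I_n -> M) :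
  mu = \sum_i a i *: delta (x i) :> (fun0 -> R^o) ->
  free_values p mu = [set r | exists (Y : pnormed p) (f : M -> Y),
    [/\ lipschitz1 f, f x0 = 0 & r = pnorm Y (\sum_i a i *: f (x i))]].
Proof.
move=> mua; apply/seteqP; split=> r /=.
  move=> [m [b [y [Y [f [mub lf f0 ->]]]]]]; exists Y, f; split=> //.
  by congr (pnorm Y _); apply: delta_rep => //; rewrite -mua -mub.
by move=> [Y [f [lf f0 ->]]]; exists n, a, x, Y, f.
Qed.

Section free_pnorm.
Context {p : R} (hp : 0 < p <= 1).
Let p0 : 0 < p. Proof. by case/andP: hp. Qed.
Implicit Types mu nu : molecule.

Lemma free_values_ubound mu : has_ubound (free_values p mu).
Proof.
have [n [a [x mua]]] := moleculeP mu.
exists ((\sum_i (`|a i| * mdist (x i) x0) `^ p) `^ p^-1) => r.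
rewrite (free_value_rep p mua) => -[Y [f [lf f0 ->]]].
rewrite -(ler_powRE p0) ?pnorm_ge0 ?powR_ge0// powRVK//; last first.
  by apply: sumr_ge0 => i _; exact: powR_ge0.
apply: le_trans (pnorm_sum _ _) _; apply: ler_sum => i _.
rewrite pnormZ ler_powRE ?mulr_ge0 ?pnorm_ge0 ?mdist_ge0//.
by rewrite ler_wpM2l// -[f (x i)]subr0 -f0.
Qed.

Lemma free_values0 mu : free_values p mu 0.
Proof.
have [n [a [x mua]]] := moleculeP mu; rewrite (free_value_rep p mua).
exists (real_line hp), (fun=> 0); split=> //.
  by move=> u v; rewrite subrr pnorm0 mdist_ge0.
by rewrite big1 ?pnorm0// => i _; rewrite scaler0.
Qed.

Lemma free_values_le mu r : free_values p mu r -> r <= free_norm p mu.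
Proof. by move=> ?; apply: ub_le_sup => //; exact: free_values_ubound. Qed.

Lemma free_norm_le mu r : (forall s, free_values p mu s -> s <= r) ->
  free_norm p mu <= r.
Proof. by move=> h; apply: ge_sup => //; exists 0; exact: free_values0. Qed.

Lemma free_norm_ge0 mu : 0 <= free_norm p mu.
Proof. exact/free_values_le/free_values0. Qed.

Lemma free_norm_eq0 mu : free_norm p mu = 0 -> mu = 0.
Proof.
move=> mu0; have [n [a [x mua]]] := moleculeP mu.
apply: val_inj; rewrite [val mu]mua; apply: group_sum; first exact: delta_x0.
move=> w wx0; pose e := \big[Num.min/mdist w x0]_(i | x i != w) mdist w (x i).
have e0 : 0 < e.
  by apply: lt_bigmin => [|i]; rewrite mdist_gt0// eq_sym.
pose f (u : M) : real_line hp := Num.max 0 (e - mdist w u).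
have lf : lipschitz1 f.
  move=> u v; rewrite /f/=.
  have := metric_triangle w u v; have := metric_triangle w v u.
  rewrite (metric_sym v u) => h1 h2.
  by rewrite ler_norml !maxEle; case: ifP; case: ifP; lra.
have f0 : f x0 = 0.
  by apply/max_idPl; rewrite subr_le0 bigmin_le_id.
have fx i : f (x i) = e * (x i == w)%:R.
  have [->|xw] := eqVneq (x i) w.
    by rewrite /f mdistxx subr0 mulr1; apply/max_idPr; exact: ltW.
  by rewrite mulr0; apply/max_idPl; rewrite subr_le0 bigmin_le_cond.
have : free_values p mu (pnorm _ (\sum_i a i *: f (x i))).
  by rewrite (free_value_rep p mua); exists (real_line hp), f.
move=> /free_values_le; rewrite mu0 => le0.
have /pnorm_eq0 : pnorm _ (\sum_i a i *: f (x i)) = 0.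
  by apply/eqP; rewrite eq_le le0 pnorm_ge0.
have -> : \sum_i a i *: f (x i) = e * \sum_(i | x i == w) a i.
  rewrite [in RHS]big_mkcond mulr_sumr; apply: eq_bigr => i _.
  by rewrite fx /GRing.scale/= mulrCA; case: eqP; rewrite ?mulr1 ?mulr0.
by move/eqP; rewrite mulf_eq0 gt_eqF//= => /eqP.
Qed.

Lemma free_normZ_le c mu : free_norm p (c *: mu) <= `|c| * free_norm p mu.
Proof.
have [n [a [x mua]]] := moleculeP mu.
have cmua : c *: mu = \sum_i (c * a i) *: delta (x i) :> (fun0 -> R^o).
  by rewrite [LHS](_ : _ = c *: (mu : fun0 -> R^o))// mua scaler_sumr;
    apply: eq_bigr => i _; rewrite scalerA.
apply: free_norm_le => r; rewrite (free_value_rep p cmua) => -[Y [f [lf f0 ->]]].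
under eq_bigr do rewrite -scalerA.
rewrite -scaler_sumr pnormZ ler_wpM2l// free_values_le//.
by rewrite (free_value_rep p mua); exists Y, f.
Qed.

Lemma free_normD mu nu :
  free_norm p (mu + nu) `^ p <= free_norm p mu `^ p + free_norm p nu `^ p.
Proof.
have [n [a [x mua]]] := moleculeP mu; have [m [b [y nub]]] := moleculeP nu.
have le0 : 0 <= free_norm p mu `^ p + free_norm p nu `^ p.
  by rewrite addr_ge0// powR_ge0.
rewrite -[leRHS](powRVK p0)// ler_powRE ?powR_ge0 ?free_norm_ge0//.
apply: free_norm_le => r [k [c [z [Y [f [munuc lf f0 ->]]]]]].
have -> : \sum_i c i *: f (z i) = \sum_i a i *: f (x i) + \sum_i b i *: f (y i).
  pose c' i := match fintype.split i with inl j => a j | inr j => b j end.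
  pose z' i := match fintype.split i with inl j => x j | inr j => y j end.
  have cz (W : lmodType R) (g : M -> W) : \sum_i c' i *: g (z' i) =
      \sum_i a i *: g (x i) + \sum_i b i *: g (y i).
    rewrite big_split_ord/=; congr (_ + _); apply: eq_bigr => i _.
      by rewrite /c' /z' (unsplitK (inl i)).
    by rewrite /c' /z' (unsplitK (inr i)).
  by rewrite -cz; apply: delta_rep => //; rewrite cz -munuc -mua -nub.
rewrite -(ler_powRE p0) ?pnorm_ge0 ?powR_ge0// powRVK//.
apply: le_trans (pnormD _ _) _.
by apply: lerD; rewrite ler_powRE ?pnorm_ge0 ?free_norm_ge0//;
  apply: free_values_le;
  [rewrite (free_value_rep p mua)|rewrite (free_value_rep p nub)]; exists Y, f.
Qed.

Lemma free_normP : is_pnorm p (free_norm p).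
Proof.
split=> //.
- exact: free_norm_ge0.
- exact: free_norm_eq0.
- move=> c mu; apply/eqP; rewrite eq_le free_normZ_le/=.
  have [->|c0] := eqVneq c 0; first by rewrite normr0 mul0r free_norm_ge0.
  rewrite -ler_pdivlMl ?normr_gt0// -normfV.
  by apply: le_trans (free_normZ_le _ _); rewrite scalerK.
- exact: free_normD.
Qed.

Definition molecules : pnormed p := PNormed free_normP.

Definition lipschitz_free : pnormed p := pcompletion molecules.

End free_pnorm.
End free_space.

(* Main.v *)
Require Import Defs.
From HB Require Import structures.
From mathcomp Require Import all_boot all_order all_algebra.
From mathcomp Require Import all_classical all_reals all_analysis.
From mathcomp Require Import lra ring.

(** Why the theorem holds. Rounding all distances up to powers of 2 replaces
the ultrametric by an ultrametric [rho] with mdist <= rho <= 2 mdist, in which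
any two different positive distances differ by a factor at least 2. Enumerate a dense
set injectively as x_0, x_1, ... with x_0 the base point, and attach x_{k+1} to
its parent, the point of least index among the rho-nearest points of
x_0, ..., x_k; let [height k] be the rho-distance to the parent. This turns the
dense set into a tree rooted at the base point, and the normalized edges
m_k = (delta x_{k+1} - delta x_{parent}) / height k will correspond to the unit
vectors e_k of ell_p.

The p-triangle inequality and [free_norm_mdeltaB] give ||m_k|| <= 1, hence
||sum c_k m_k||^p <= sum |c_k|^p. The reverse estimate comes from one Lipschitz
map into ell_p. The k-th coordinate of u is height k if rho u x_{k+1} < height k,
that is (for u in the tree), if x_{k+1} is u or an ancestor of u, and 0 otherwise. The balls
that contain a given point are nested, and their radii at least halve at each
step, so the p-th powers of the radii not exceeding r add up to at most a
constant times r^p ([geometric_sum]); since balls of radius greater than rho u v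
do not separate u from v, the map is Lipschitz ([coordinate_lipschitz]). The
choice of the parent with least index makes the coordinates of a point and of
its parent differ in a single place ([coordinate_par]), so that the linear
extension T of the map to molecules sends m_k to e_k.

The m_k span a dense subspace, because differences along branches recover
each delta x_n, and x -> delta x is Lipschitz. So T is bounded, bounded below
and has dense range ([unit_vector_isomorphism]), and such an operator extends
to an isomorphism of the completion onto the complete space ell_p
([completion_isomorphism]). *)

Set Implicit Arguments.
Unset Strict Implicit.
Unset Printing Implicit Defensive.

Import Order.TTheory GRing.Theory Num.Theory.
Import numFieldNormedType.Exports.

Local Open Scope classical_set_scope.
Local Open Scope ring_scope.

(** * Null sequences in p-normed spaces *)

Lemma cvg_powR (R : realType) (p : R) (w : nat -> R) (l : R) : 0 < p ->
  (forall n, 0 <= w n) -> 0 <= l ->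
  (w n @[n --> \oo] --> l) -> (w n `^ p @[n --> \oo] --> l `^ p).
Proof.
move=> p0 w0 l0 wl; rewrite -[p in l `^ p]invrK.
apply: cvg_powR_root; rewrite ?invr_gt0//.
  by move=> n; exact: powR_ge0.
by rewrite (_ : (fun n => _) = w)//; apply/funext => n; rewrite powRKV.
Qed.

Section null_sequences.
Context {R : realType} {p : R} {X : pnormed p}.
Implicit Types (u : nat -> X) (l : X).

(** The p-norm itself need not be Lipschitz, but its p-th power satisfies the
reverse triangle inequality; the limit is taken there. *)
Lemma pnorm_cvg u l : null_seq (fun n => u n - l) ->
  pnorm X (u n) @[n --> \oo] --> pnorm X l.
Proof.
move=> h; have p0 := pn_exp0 X.
rewrite -[pnorm X l](powRKV p0) ?pnorm_ge0//.
apply: cvg_powR_root; rewrite ?powR_ge0//.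
  by move=> n; exact: pnorm_ge0.
have := @cvg_powR _ _ _ _ p0 (fun n => pnorm_ge0 _) (lexx 0) h.
rewrite powR0 ?gt_eqF// => hp.
rewrite -[pnorm X l `^ p]add0r.
rewrite (_ : (fun n => _) =
    (fun n => (pnorm X (u n) `^ p - pnorm X l `^ p) + pnorm X l `^ p)); last first.
  by apply/funext => n; rewrite subrK.
apply: cvgD; last exact: cvg_cst.
apply/norm_cvg0P; apply: (squeeze_cvgr _ (cvg_cst 0) hp).
by apply: nearW => n; rewrite normr_ge0/= pnorm_dist.
Qed.

Lemma null_seq_bounded (Y : pnormed p) (v : nat -> Y) u C :
  (forall n, pnorm X (u n) <= C * pnorm Y (v n)) -> null_seq v -> null_seq u.
Proof.
move=> le h; rewrite /null_seq; apply: squeeze_cvgr (cvg_cst 0) _.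
  by apply: nearW => n; rewrite pnorm_ge0/=; exact: le.
by rewrite -(mulr0 C); apply: cvgM => //; exact: cvg_cst.
Qed.

Lemma null_seq_cauchy u l : null_seq (fun n => u n - l) -> pcauchy u.
Proof.
move=> /null_pcauchy h e e0; have [k hk] := h e e0; exists k => m n km kn.
by have := hk m n km kn; rewrite opprB subrKA.
Qed.

End null_sequences.

Lemma pcauchy_bounded (R : realType) (p : R) (X Y : pnormed p)
    (u : nat -> X) (v : nat -> Y) C :
  (forall m n, pnorm Y (v m - v n) <= C * pnorm X (u m - u n)) ->
  pcauchy u -> pcauchy v.
Proof.
move=> le cu e e0; have C0 : 0 < `|C| + 1 by rewrite ltr_wpDl.
have [k hk] := cu _ (divr_gt0 e0 C0); exists k => m n km kn.
apply: (le_lt_trans (le m n)); apply: (@le_lt_trans _ _ ((`|C| + 1) * pnorm X (u m - u n))).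
  by rewrite ler_wpM2r ?pnorm_ge0// (le_trans (ler_norm C))// lerDl.
by rewrite mulrC -ltr_pdivlMr// hk.
Qed.

(** * Extending an operator to the completion *)

Section completion_isomorphism.
Context {R : realType} {p : R} {X Y : pnormed p}.
Variables (T : {linear X -> Y}) (A B : R).
Hypothesis Y_complete : forall v : nat -> Y, pcauchy v ->
  exists l, null_seq (fun n => v n - l).
Hypothesis T_le : forall x, pnorm Y (T x) <= B * pnorm X x.
Hypothesis T_ge : forall x, pnorm X x <= A * pnorm Y (T x).
Hypothesis T_dense : forall y, exists u : nat -> X, null_seq (fun n => T (u n) - y).

(** The graph of the extension of [T]. Keeping it as a relation makes the
extension and its inverse symmetric: existence, linearity and the two bounds
yield both functions. *)
Definition extension_rel (z : pcompletion X) (y : Y) :=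
  exists2 u : cauchy_seq X, z = (\pi_(completion X) u)%qT & null_seq (fun n => T (u n) - y).

(** Here completeness of [Y] is used: the image of a Cauchy sequence converges. *)
Lemma extension_exists z : exists y, extension_rel z y.
Proof.
elim/(@completion_ind _ _ X): z => u.
have cTu : pcauchy (fun n => T (u n)).
  apply: (pcauchy_bounded (C := B)) (cauchy_seqP u) => m n.
  by rewrite -linearB; exact: T_le.
by have [y hy] := Y_complete cTu; exists y, u.
Qed.

Lemma extension_linear a z z' y y' : extension_rel z y -> extension_rel z' y' ->
  extension_rel (a *: z + z') (a *: y + y').
Proof.
move=> [u -> uy] [v -> vy]; exists (a *: u + v).
  by rewrite completion_piZ completion_piD.
have := null_seqD (null_seqZ a uy) vy; congr null_seq; apply/funext => n.
rewrite addrfctE scalrfctE [RHS](_ : _ = T (a *: u n + v n) - (a *: y + y'))//.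
by rewrite linearP scalerBr opprD addrACA.
Qed.

Lemma extension_le z y : extension_rel z y ->
  pnorm Y y <= B * pnorm (pcompletion X) z /\
  pnorm (pcompletion X) z <= A * pnorm Y y.
Proof.
move=> [u -> uy]; have hu := completion_norm_cvg X u.
have hy := pnorm_cvg uy; split.
  apply: ler_cvg_to hy (cvgM (cvg_cst B) hu) _.
  by apply: nearW => n; exact: T_le.
apply: ler_cvg_to hu (cvgM (cvg_cst A) hy) _.
by apply: nearW => n; exact: T_ge.
Qed.

Lemma extension_uniqr z y y' : extension_rel z y -> extension_rel z y' -> y = y'.
Proof.
move=> h h'; have := extension_linear (-1) h h'; rewrite scaleN1r addNr scaleN1r.
move=> /extension_le[]; rewrite pnorm0 mulr0 => le0 _.
apply/eqP; rewrite eq_sym -subr_eq0 addrC; apply/eqP/pnorm_eq0/eqP.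
by rewrite eq_le le0 pnorm_ge0.
Qed.

Lemma extension_uniql z z' y : extension_rel z y -> extension_rel z' y -> z = z'.
Proof.
move=> h h'; have := extension_linear (-1) h h'; rewrite scaleN1r scaleN1r addNr.
move=> /extension_le[_]; rewrite pnorm0 mulr0 => le0.
apply/eqP; rewrite eq_sym -subr_eq0 addrC; apply/eqP/pnorm_eq0/eqP.
by rewrite eq_le le0 pnorm_ge0.
Qed.

(** The lower bound turns a sequence whose images converge to [y] into a Cauchy
sequence, whose class is the preimage. *)
Lemma extension_surj y : exists z, extension_rel z y.
Proof.
have [u uy] := T_dense y.
have cu : pcauchy u.
  apply: (pcauchy_bounded (C := A)) (null_seq_cauchy uy) => m n.
  by rewrite -linearB; exact: T_ge.
pose v := CauchySeq (asboolT cu : u \in pcauchy_pred X).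
by exists (\pi_(completion X) v)%qT, v.
Qed.

(** An operator bounded above and below is injective with closed range after
extension to the completion; dense range then makes it onto. *)
Lemma completion_isomorphism : linearly_isomorphic (pcompletion X) Y.
Proof.
have [t ht] := choice extension_exists; have [s hs] := choice extension_surj.
have tlin : linear t.
  by move=> a z z'; apply: extension_uniqr (ht _) (extension_linear _ (ht z) (ht z')).
have slin : linear s.
  by move=> a y y'; apply: extension_uniql (hs _) (extension_linear _ (hs y) (hs y')).
pose tl : {linear pcompletion X -> Y} := HB.pack t (GRing.isLinear.Build _ _ _ _ t tlin).
pose sl : {linear Y -> pcompletion X} := HB.pack s (GRing.isLinear.Build _ _ _ _ s slin).
exists tl, sl, (Num.max A B); split.
- by move=> z; exact: extension_uniql (hs _) (ht z).
- by move=> y; exact: extension_uniqr (ht _) (hs y).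
- move=> z; have [le _] := extension_le (ht z); apply: le_trans le _.
  by rewrite ler_wpM2r ?pnorm_ge0// le_max lexx orbT.
- move=> y; have [_ le] := extension_le (hs y); apply: le_trans le _.
  by rewrite ler_wpM2r ?pnorm_ge0// le_max lexx.
Qed.

End completion_isomorphism.

(** * The space ell_p *)

Section ell_facts.
Context {R : realType} {p : R} (hp : 0 < p <= 1).
Let p0 : 0 < p. Proof. by case/andP: hp. Qed.
Implicit Types y : ell_seq hp.

Lemma psum_le_ell_norm y N :
  \sum_(0 <= k < N) `|y k| `^ p <= ell_norm y `^ p.
Proof.
by rewrite ell_normE; exact: nondecreasing_cvgn_le (ell_series_nd y) (ell_seqP y) N.
Qed.

Lemma ell_norm_le y B : (forall N, \sum_(0 <= k < N) `|y k| `^ p <= B) ->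
  ell_norm y `^ p <= B.
Proof.
by move=> le; rewrite ell_normE; apply: limr_le (ell_seqP y) _; apply: nearW.
Qed.

Lemma ell_pred_bounded (v : nat -> R^o) B : (forall N, \sum_(0 <= k < N) `|v k| `^ p <= B) ->
  v \in ell_pred hp.
Proof.
move=> le; apply/asboolP; apply: nondecreasing_is_cvgn; first exact: ell_series_nd.
by exists B => _ [N _ <-]; exact: le.
Qed.

Lemma le_ell_norm y k : `|y k| <= ell_norm y.
Proof.
rewrite -(ler_powRE p0) ?powR_ge0//; apply: le_trans (psum_le_ell_norm y k.+1).
by rewrite big_nat_recr//= lerDr sumr_ge0// => i _; exact: powR_ge0.
Qed.

(** The limit is taken coordinatewise; membership in ell_p and convergence in
p-norm both follow from bounding finite partial sums of the tails. *)
Lemma ell_complete (u : nat -> ell hp) : pcauchy u ->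
  exists l : ell hp, null_seq (fun n => u n - l).
Proof.
move=> cu; pose U n : nat -> R^o := ell_val (u n).
have /choice[l hl] k : exists l : R, U n k @[n --> \oo] --> l.
  suff : cvgn (fun n => U n k) by move=> /cvg_ex.
  apply/cauchy_cvgP/cauchy_exP => e e0; have [N hN] := cu _ e0.
  exists (U N k); exists N => // n Nn; rewrite /ball/=.
  exact: le_lt_trans (le_ell_norm (u N - u n : ell_seq hp) k) (hN _ _ _ Nn).
have tail e : 0 < e -> exists n0, forall n, (n0 <= n)%N -> forall N,
    \sum_(0 <= k < N) `|U n k - l k| `^ p <= e `^ p.
  move=> e0; have [n0 h0] := cu _ e0; exists n0 => n nn N.
  have : (\sum_(0 <= k < N) `|U n k - U m k| `^ p) @[m --> \oo] -->
      \sum_(0 <= k < N) `|U n k - l k| `^ p.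
    apply: cvg_big => [|k _]; first exact: add_continuous.
    apply: cvg_powR => //; apply: cvg_norm; apply: cvgB; [exact: cvg_cst|exact: hl].
  move=> /cvgr_to_le; apply; exists n0 => // m /= nm.
  apply: le_trans (psum_le_ell_norm (u n - u m : ell_seq hp) N) _.
  by rewrite ler_powRE ?powR_ge0 ?(ltW e0)// ltW//; exact: h0.
have tail_mem e n : (forall N, \sum_(0 <= k < N) `|U n k - l k| `^ p <= e) ->
    (U n - (l : nat -> R^o)) \in ell_pred hp by exact: ell_pred_bounded.
have [n1 h1] := tail _ ltr01.
have lmem : (l : nat -> R^o) \in ell_pred hp.
  have := tail_mem _ _ (h1 n1 (leqnn _)); have := valP (u n1 : ell_seq hp).
  move=> a b; have := rpredB a b.
  by rewrite opprB addrC subrK.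
exists (EllSeq lmem); apply/null_seqP => e e0.
have e20 : 0 < e / 2 by rewrite divr_gt0.
have [n0 h0] := tail _ e20; exists n0 => n nn.
apply: (@le_lt_trans _ _ (e / 2)); last by lra.
rewrite -(ler_powRE p0) ?pnorm_ge0 ?(ltW e20)//.
exact: (@ell_norm_le (u n - EllSeq lmem : ell_seq hp) _ (h0 n nn)).
Qed.

(** The truncations are given up to their coordinates only, because they
arise as images of finite combinations under an operator. *)
Lemma ell_trunc_cvg (y : ell hp) (t : nat -> ell hp) :
  (forall n k, (t n : ell_seq hp) k = if (k < n)%N then (y : ell_seq hp) k else 0) ->
  null_seq (fun n => t n - y).
Proof.
move=> ht; set S := ell_norm (y : ell_seq hp) `^ p.
have hS : series (fun n => `|(y : ell_seq hp) n| `^ p) n @[n --> \oo] --> S.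
  by rewrite /S ell_normE; exact: ell_seqP.
have le n : pnorm (ell hp) (t n - y) `^ p <=
    S - series (fun n => `|(y : ell_seq hp) n| `^ p) n.
  apply: (@ell_norm_le (t n - y : ell_seq hp)) => N.
  (* Coordinatewise, y is split between the tail t n - y and the head t n. *)
  rewrite lerBrDr; apply: le_trans (psum_le_ell_norm y (maxn N n)).
  rewrite (@le_trans _ _ (\sum_(0 <= k < maxn N n)
     (`|(t n - y : ell_seq hp) k| `^ p + `|(t n : ell_seq hp) k| `^ p)))//.
    rewrite big_split/= lerD//.
      rewrite [leRHS](big_cat_nat (n := N))//= ?leq_maxl// lerDl sumr_ge0//.
    rewrite [leRHS](big_cat_nat (n := n))//= ?leq_maxr//.
    rewrite /series/= [X in _ <= X + _](_ : _ = \sum_(0 <= k < n) `|(y : ell_seq hp) k| `^ p).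
      by rewrite lerDl sumr_ge0// => i _; exact: powR_ge0.
    by apply: eq_big_nat => i /andP[_ lin]; rewrite ht lin.
  apply: ler_sum => k _.
  rewrite (_ : (t n - y : ell_seq hp) k = (t n : ell_seq hp) k - (y : ell_seq hp) k)//.
  rewrite ht; case: ifP => _; last by rewrite sub0r normrN normr0 powR0 ?addr0 ?gt_eqF.
  by rewrite subrr normr0 powR0 ?add0r ?gt_eqF.
rewrite /null_seq.
have -> : (0 : R) = 0 `^ p^-1 by rewrite powR0// invr_eq0 gt_eqF.
apply: cvg_powR_root => //; first by move=> n; exact: pnorm_ge0.
apply: (squeeze_cvgr _ (cvg_cst 0)); first by apply: nearW => n; rewrite powR_ge0/=; exact: le.
by rewrite -(subrr S); apply: cvgB => //; exact: cvg_cst.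
Qed.

End ell_facts.

(** * Operators that map a total sequence to the unit vectors *)

Section dense_span.
Context {R : realType} {p : R} {X : pnormed p}.

(** The representation is required at every length n >= N, so that two
combinations of different lengths can be added term by term. *)
Definition fin_span (m : nat -> X) (mu : X) := exists N (c : nat -> R),
  forall n, (N <= n)%N -> mu = \sum_(0 <= k < n) c k *: m k.

Lemma fin_span_linear m a mu nu : fin_span m mu -> fin_span m nu -> fin_span m (a *: mu + nu).
Proof.
move=> [N [c hc]] [N' [c' hc']]; exists (maxn N N'), (fun k => a * c k + c' k) => n.
rewrite geq_max => /andP[/hc -> /hc' ->].
by rewrite scaler_sumr -big_split/=; apply: eq_bigr => k _; rewrite scalerDl scalerA.
Qed.

Lemma fin_span0 m : fin_span m 0.
Proof. by exists 0%N, (fun=> 0) => n _; rewrite big1// => k _; rewrite scale0r. Qed.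

Lemma fin_span_gen m k : fin_span m (m k).
Proof.
exists k.+1, (fun j => (j == k)%:R) => n kn.
rewrite (big_cat_nat (n := k))//= 1?ltnW// [X in _ + X]big_ltn// eqxx scale1r.
rewrite big_nat big1 ?add0r => [|j /andP[_ jk]]; last by rewrite ltn_eqF// scale0r.
rewrite big_nat big1 ?addr0// => j /andP[kj _]; by rewrite gtn_eqF// scale0r.
Qed.

Definition closed_span (m : nat -> X) (mu : X) := exists2 u : nat -> X,
  (forall n, fin_span m (u n)) & null_seq (fun n => u n - mu).

Lemma closed_span_linear m a mu nu :
  closed_span m mu -> closed_span m nu -> closed_span m (a *: mu + nu).
Proof.
move=> [u um umu] [v vm vnu]; exists (a *: u + v) => [n|]; first exact: fin_span_linear.
have := null_seqD (null_seqZ a umu) vnu; congr null_seq; apply/funext => n.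
by rewrite !addrfctE !scalrfctE scalerBr opprD addrACA.
Qed.

Lemma fin_span_closed m mu : fin_span m mu -> closed_span m mu.
Proof.
exists (fun=> mu) => //; rewrite (_ : (fun n => _) = 0); first exact: null_seq0.
by apply/funext => n; rewrite subrr.
Qed.

End dense_span.

(** Since the p-norm is p-subadditive, a combination of the [m k] is bounded by
the ell_p norm of its coefficients, that is, of its image; by density this
lower bound on [T] extends to all of [X], and the truncations of an element of
ell_p show that the range is dense. *)
Lemma unit_vector_isomorphism (R : realType) (p : R) (hp : 0 < p <= 1)
    (X : pnormed p) (T : {linear X -> ell hp}) (K : R) (m : nat -> X) :
  (forall v, pnorm (ell hp) (T v) <= K * pnorm X v) ->
  (forall k, pnorm X (m k) <= 1) ->
  (forall k j, (T (m k) : ell_seq hp) j = (j == k)%:R) ->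
  (forall v, closed_span m v) ->
  linearly_isomorphic (pcompletion X) (ell hp).
Proof.
move=> T_le m_le Tm m_total; have p0 := pn_exp0 X.
have Tsum n (c : nat -> R) j : (T (\sum_(0 <= k < n) c k *: m k) : ell_seq hp) j =
    if (j < n)%N then c j else 0.
  elim: n => [|n IHn]; first by rewrite big_geq// linear0.
  rewrite big_nat_recr//= linearD linearZ.
  transitivity ((T (\sum_(0 <= k < n) c k *: m k) : ell_seq hp) j +
    c n * (T (m n) : ell_seq hp) j) => //.
  by rewrite IHn Tm ltnS; case: ltngtP; rewrite ?mulr0 ?addr0 ?mulr1 ?add0r// => ->.
have span_le v : fin_span m v -> pnorm X v <= pnorm (ell hp) (T v).
  move=> [N [c /(_ N (leqnn N)) ->]]; rewrite -(ler_powRE p0) ?pnorm_ge0//.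
  apply: le_trans (psum_le_ell_norm (T _ : ell_seq hp) N).
  apply: le_trans (pnorm_sum _ _) _; apply: ler_sum_nat => k /andP[_ kN].
  by rewrite Tsum kN ler_powRE ?pnorm_ge0// pnormZ ler_piMr.
apply: (@completion_isomorphism _ _ _ _ T 1 K) => [v|//|v|y].
- exact: ell_complete.
- have [u um uv] := m_total v; rewrite mul1r.
  have Tuv : null_seq (fun n => T (u n) - T v).
    by apply: (null_seq_bounded (C := K)) uv => n; rewrite -linearB.
  apply: ler_cvg_to (pnorm_cvg uv) (pnorm_cvg Tuv) _.
  by apply: nearW => n; exact: span_le.
- exists (fun n => \sum_(0 <= k < n) (y : ell_seq hp) k *: m k).
  by apply: ell_trunc_cvg => n k; exact: Tsum.
Qed.

(** * Molecules *)

Section free_space_facts.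
Context {R : realType} {M : metricType R} (x0 : M).

Lemma delta_mem x : delta x \in @molecule_pred R M x0.
Proof.
apply/asboolP; exists 1%N, (fun=> 1), (fun=> x).
by rewrite big_ord1 scale1r.
Qed.

(** The canonical embedding of the metric space into its molecules. *)
Definition mdelta x : molecule x0 := Molecule (delta_mem x).

Lemma molecule_sumE n (a : 'I_n -> R) (x : 'I_n -> M) (mu : molecule x0) :
  mu = \sum_i a i *: delta (x i) :> (fun0 x0 -> R^o) <->
  mu = \sum_i a i *: mdelta (x i).
Proof.
have vE : \val (\sum_i a i *: mdelta (x i)) = \sum_i a i *: delta (x i).
  by rewrite raddf_sum; apply: eq_bigr => i _.
by split=> [e|->//]; apply: val_inj; rewrite vE.
Qed.

Lemma molecule_mdeltas (mu : molecule x0) : exists n (a : 'I_n -> R) (x : 'I_n -> M),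
  mu = \sum_i a i *: mdelta (x i).
Proof.
by have [n [a [x /molecule_sumE ->]]] := moleculeP mu; exists n, a, x.
Qed.

Lemma mdelta_x0 : mdelta x0 = 0.
Proof. by apply: val_inj; exact: delta_x0. Qed.

Context {p : R} (hp : 0 < p <= 1).

(** Each admissible map is 1-Lipschitz, so its value at this molecule is at most
the distance. *)
Lemma free_norm_mdeltaB x y : free_norm p (mdelta x - mdelta y) <= mdist x y.
Proof.
pose a (i : 'I_2) : R := (-1) ^+ i.
pose z (i : 'I_2) : M := if i == 0 then x else y.
have e : mdelta x - mdelta y = \sum_i a i *: mdelta (z i).
  by rewrite !big_ord_recr big_ord0/= add0r /a /z/= expr0 expr1 scale1r scaleN1r.
apply: free_norm_le => // r; move/molecule_sumE : e => e.
rewrite (free_value_rep p e) => -[Y [f [lf f0 ->]]].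
rewrite !big_ord_recr big_ord0/= add0r /a /z/= expr0 expr1 scale1r scaleN1r.
exact: lf.
Qed.

(** The universal property of molecules. The bound holds because [f] divided by
[C] is one of the maps over which the supremum defining the norm is taken. *)
Lemma lipschitz_extension (Y : pnormed p) (f : M -> Y) (C : R) : 0 < C ->
  f x0 = 0 -> (forall x y, pnorm Y (f x - f y) <= C * mdist x y) ->
  exists2 T : {linear molecules x0 hp -> Y}, (forall x, T (mdelta x) = f x) &
    forall mu, pnorm Y (T mu) <= C * free_norm p mu.
Proof.
move=> C0 f0 lf.
have /choice[t ht] mu : exists y, forall n (a : 'I_n -> R) (x : 'I_n -> M),
    mu = \sum_i a i *: mdelta (x i) -> y = \sum_i a i *: f (x i).
  have [n [a [x mua]]] := moleculeP mu.
  exists (\sum_i a i *: f (x i)) => m b z /molecule_sumE mub.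
  by apply: (delta_rep f0); rewrite -mua -mub.
have tlin : linear (t : molecules x0 hp -> Y).
  move=> c mu nu; have [n [a [x mua]]] := molecule_mdeltas mu.
  have [m [b [z nub]]] := molecule_mdeltas nu.
  rewrite (ht _ _ _ _ mua) (ht _ _ _ _ nub).
  pose c' i := match fintype.split i with inl j => c * a j | inr j => b j end.
  pose z' i := match fintype.split i with inl j => x j | inr j => z j end.
  have cz (W : lmodType R) (g : M -> W) : \sum_i c' i *: g (z' i) =
      c *: \sum_i a i *: g (x i) + \sum_i b i *: g (z i).
    rewrite big_split_ord/= scaler_sumr; congr (_ + _); apply: eq_bigr => i _.
      by rewrite /c' /z' (unsplitK (inl i)) scalerA.
    by rewrite /c' /z' (unsplitK (inr i)).
  rewrite -cz; apply: ht; rewrite cz -mua -nub; exact: erefl.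
pose T : {linear molecules x0 hp -> Y} :=
  HB.pack (t : molecules x0 hp -> Y) (GRing.isLinear.Build _ _ _ _ _ tlin).
exists T => [x|mu].
  rewrite [T _](ht _ 1%N (fun=> 1) (fun=> x)) ?big_ord1 ?scale1r//.
have [n [a [x mua]]] := moleculeP mu.
rewrite [T _](ht _ n a x); last exact/molecule_sumE.
rewrite -ler_pdivrMl// -[C^-1]gtr0_norm ?invr_gt0// -pnormZ.
apply: (free_values_le hp); rewrite (free_value_rep p mua).
exists Y, (fun x => C^-1 *: f x); split.
- move=> u v; rewrite -scalerBr pnormZ gtr0_norm ?invr_gt0//.
  by rewrite ler_pdivrMl.
- by rewrite f0 scaler0.
- rewrite scaler_sumr; congr pnorm; apply: eq_bigr => i _.
  by rewrite !scalerA mulrC.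
Qed.

(** As point evaluations are Lipschitz, the molecules at the points of a dense
sequence suffice. *)
Lemma closed_span_molecules (x : nat -> M) (m : nat -> molecules x0 hp) :
  (forall u e, 0 < e -> exists n, mdist u (x n) < e) ->
  (forall n, fin_span m (mdelta (x n))) -> forall mu, closed_span m mu.
Proof.
move=> x_dense x_span mu.
have u_closed u : closed_span m (mdelta u).
  have /choice[j hj] n : exists i, mdist u (x i) < n.+1%:R^-1.
    by apply: x_dense; rewrite invr_gt0.
  exists (fun n => mdelta (x (j n))) => [n|]; first exact: x_span.
  apply/null_seqP => e e0; have [N _ hN] := near_infty_natSinv_lt (PosNum e0).
  exists N => n Nn; apply: le_lt_trans (free_norm_mdeltaB _ _) _.
  by rewrite metric_sym (lt_trans (hj n))//; exact: hN.
have [n [a [z ->]]] := molecule_mdeltas mu.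
elim/big_rec: _ => [|i nu _ hnu]; first exact/fin_span_closed/fin_span0.
exact: closed_span_linear (u_closed (z i)) hnu.
Qed.

End free_space_facts.

(** * Rounding, nearest points and geometric sums *)

Section dyadic_rounding.
Context {R : realType}.
Implicit Types s t : R.

(** For positive [t], the least power of 2 not below [t]. *)
Definition dyadic t : R :=
  if 0 < t then 2 `^ (Num.ceil (ln t / ln 2))%:~R else 0.

Let ln2_gt0 : 0 < ln (2 : R). Proof. by rewrite ln_gt0// ltr1n. Qed.

Let powR_log2 t : 0 < t -> 2 `^ (ln t / ln 2) = t.
Proof.
by move=> t0; rewrite /powR gt_eqF// divfK ?gt_eqF// lnK.
Qed.

Let mul2_powR u : 2 * 2 `^ u = 2 `^ (1 + u) :> R.
Proof. by rewrite powRD ?powRr1// pnatr_eq0 implybT. Qed.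

Lemma dyadic_ge0 t : 0 <= dyadic t.
Proof. by rewrite /dyadic; case: ifP => // _; exact: powR_ge0. Qed.

Lemma dyadic_ge t : t <= dyadic t.
Proof.
rewrite /dyadic; case: ltP => // t0.
by rewrite -[leLHS]powR_log2// ler_powR ?ler1n// ceil_ge.
Qed.

Lemma dyadic_le t : 0 <= t -> dyadic t <= 2 * t.
Proof.
rewrite /dyadic le_eqVlt => /predU1P[<-|t0]; first by rewrite ltxx mulr0.
rewrite t0 -[in leRHS](powR_log2 t0) mul2_powR.
rewrite ler_powR ?ler1n//.
by have := ceilB1_lt (ln t / ln 2); rewrite intrB; lra.
Qed.

Lemma le_dyadic : {homo dyadic : s t / s <= t}.
Proof.
move=> s t st; rewrite {1}/dyadic; case: ltP => [s0|_]; last exact: dyadic_ge0.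
have t0 := lt_le_trans s0 st.
rewrite /dyadic t0 ler_powR ?ler1n// ler_int le_ceil//.
by rewrite ler_wpM2r ?invr_ge0 ?(ltW ln2_gt0)// ler_ln.
Qed.

Lemma dyadic_gap s t : dyadic s < dyadic t -> 2 * dyadic s <= dyadic t.
Proof.
rewrite /dyadic; have [s0|_] := ltP 0 s; have [t0|_] := ltP 0 t;
  rewrite ?mulr0 ?powR_ge0//.
- move=> st; rewrite mul2_powR.
  rewrite ler_powR ?ler1n// -(intrD _ 1) ler_int addrC.
  rewrite lezD1 ltNge; apply: contraTN st => ts.
  by rewrite -leNgt ler_powR ?ler1n// ler_int.
- by rewrite ltNge powR_ge0.
Qed.

End dyadic_rounding.

(** The least minimizer; its minimality is what separates a parent from
the other nearest points. *)
Lemma first_argmin (R : realType) (g : nat -> R) n : (0 < n)%N ->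
  exists j, [/\ (j < n)%N, forall i, (i < n)%N -> g j <= g i &
                forall i, (i < j)%N -> g j < g i].
Proof.
case: n => // n _; elim: n => [|n [j [jn le lt]]].
  by exists 0%N; split=> // -[].
have [gjn|gnj] := leP (g j) (g n.+1).
  exists j; split=> //; first exact: ltnW.
  by move=> i; rewrite ltnS leq_eqVlt => /predU1P[->//|]; exact: le.
exists n.+1; split=> // i.
  rewrite ltnS leq_eqVlt => /predU1P[->//|/le]; apply: le_trans; exact: ltW.
by move=> /le; apply: lt_le_trans.
Qed.

Lemma powR_half_lt1 (R : realType) (p : R) : 0 < p -> 2^-1 `^ p < 1 :> R.
Proof. by move=> p0; have := @ltr_powRE R p 2^-1 1 p0; rewrite powR1 => ->; lra. Qed.

(** The selected terms at least halve at each step, so their p-th powers are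
dominated by a geometric series of ratio 2^-p whose first term is at most [r `^ p]. *)
Lemma geometric_sum (R : realType) (p : R) (h : nat -> R) (S : pred nat) :
  0 < p -> (forall k, 0 <= h k) ->
  (forall k l, (k < l)%N -> S k -> S l -> 2 * h l <= h k) ->
  forall m n r, 0 <= r ->
  \sum_(m <= k < n | S k && (h k <= r)) h k `^ p <= (1 - 2^-1 `^ p)^-1 * r `^ p.
Proof.
move=> p0 h0 hS m n; move: {-1}(n - m)%N (erefl (n - m)%N) => d.
have q1 := @powR_half_lt1 R p p0.
have C0 : 0 < (1 - 2^-1 `^ p)^-1 :> R by rewrite invr_gt0 subr_gt0.
set C := _^-1 in C0 *.
have CE : 1 + C * 2^-1 `^ p = C.
  by rewrite /C; field; rewrite subr_eq0 gt_eqF.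
(* Induction on the length of the range: a selected first term h m bounds the
   later selected ones by h m / 2, so the hypothesis applies with r := h m / 2. *)
elim: d m => [|d IHd] m nm r r0.
  by rewrite big_geq ?mulr_ge0 ?powR_ge0 ?ltW// -subn_eq0 nm.
have mn : (m < n)%N by rewrite -subn_gt0 nm.
have nm1 : (n - m.+1)%N = d by rewrite subnS nm.
rewrite big_ltn_cond//; case: ifP => [/andP[Sm hmr]|_]; last exact: IHd.
apply: (@le_trans _ _ (C * h m `^ p)); last by rewrite ler_pM2l// ler_powRE.
rewrite -[in leRHS]CE mulrDl mul1r lerD2l -mulrA -powRM ?h0//.
have hm2 : 0 <= 2^-1 * h m by rewrite mulr_ge0.
apply: le_trans (IHd _ nm1 _ hm2).
rewrite big_mkcond [leRHS]big_mkcond/= !big_nat; apply: ler_sum => k /andP[mk _].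
case: ifP => [/andP[Sk _]|_]; last by case: ifP => // _; exact: powR_ge0.
by rewrite Sk/= ifT//; have := hS _ _ mk Sm Sk; lra.
Qed.

(** A dense set in an infinite metric space is infinite, finite sets being
closed; the base point is removed from it and put in front. *)
Lemma dense_sequence (R : realType) (M : metricType R) (x0 : M) :
  infinite_set [set: M] -> separable M ->
  exists x : nat -> M, [/\ x 0%N = x0, injective x &
    forall y e, 0 < e -> exists n, mdist y (x n) < e].
Proof.
move=> infM [D cD dD].
have infD : infinite_set D.
  move=> finD; apply: infM; apply: (sub_finite_set _ finD) => y _.
  have /accessible_finite_set_closed/(_ _ finD) clD : accessible_space M.
    exact/hausdorff_accessible/metric_hausdorff.
  apply: contrapT => nDy.
  have [z [nDz Dz]] := dD (~` D) (ex_intro _ y nDy) (closed_openC clD).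
  exact: nDz.
have infE : infinite_set (D `\ x0) by exact: infinite_setD.
have cE : countable (D `\ x0) by apply: sub_countable cD; apply: subset_card_le; apply: subDsetl.
have := eq_card_nat cE infE; rewrite card_eq_sym => /card_bijP[f bf].
have finj : injective f by exact: bij_inj.
pose g n := set_val (f (SigSub (mem_set (I : [set: nat] n)))).
exists (fun n => if n is k.+1 then g k else x0); split=> //.
- have gx0 n : g n <> x0 by have /set_mem[] := valP (f (SigSub (mem_set (I : [set: nat] n)))).
  move=> [|m] [|n]// => [/esym/gx0//|/gx0//|].
  by move=> /val_inj/finj[->].
- move=> y e e0.
  have [z [Bz Dz]] : ((ball y e)° `&` D) !=set0.
    apply: dD; last exact: open_interior.
    by exists y; exact: nbhsx_ballx.
  have {Bz} : ball y e z by exact: interior_subset.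
  rewrite ballEmdist/= => yz.
  have [zx0|zx0] := eqVneq z x0; first by exists 0%N; rewrite -zx0.
  have Ez : z \in D `\ x0 by apply/mem_set; split => //; exact/eqP.
  have [f' _ fK] := bf.
  case e' : (f' (SigSub Ez)) => [n nT]; exists n.+1.
  rewrite /g (_ : SigSub _ = f' (SigSub Ez)) ?fK//.
  by rewrite e'; exact: val_inj.
Qed.

(** * The tree of a dense sequence *)

Section ultrametric_tree.
Context {R : realType} {M : metricType R} (x : nat -> M).
Hypothesis M_ultrametric : ultrametric M.
Hypothesis x_inj : injective x.
Implicit Types u v w : M.

Definition rho u v : R := dyadic (mdist u v).

Lemma rho_sym u v : rho u v = rho v u.
Proof. by rewrite /rho metric_sym. Qed.

Lemma rho_max u v w : rho u w <= Num.max (rho u v) (rho v w).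
Proof.
apply: le_trans (le_dyadic (M_ultrametric u v w)) _.
by rewrite le_max; have [_|_] := leP (mdist u v) (mdist v w); rewrite lexx ?orbT.
Qed.

Lemma rho_le u v w r : rho u v <= r -> rho v w <= r -> rho u w <= r.
Proof.
by move=> uv vw; apply: le_trans (rho_max u v w) _; rewrite ge_max uv.
Qed.

Lemma rho_lt u v w r : rho u v < r -> rho v w < r -> rho u w < r.
Proof.
by move=> uv vw; apply: le_lt_trans (rho_max u v w) _; rewrite gt_max uv.
Qed.

Variable par : nat -> nat.
Hypothesis par_first : forall k, [/\ (par k < k.+1)%N,
  forall i, (i < k.+1)%N -> rho (x k.+1) (x (par k)) <= rho (x k.+1) (x i) &
  forall i, (i < par k)%N -> rho (x k.+1) (x (par k)) < rho (x k.+1) (x i)].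

Definition height k : R := rho (x k.+1) (x (par k)).
(** In terms of the tree, for a point [u] of the sequence: [x k.+1] is [u] or
an ancestor of [u]. *)
Definition below k u : bool := rho u (x k.+1) < height k.
Definition coordinate u k : R^o := if below k u then height k else 0.

Lemma height_ge0 k : 0 <= height k.
Proof. exact: dyadic_ge0. Qed.

Lemma height_gt0 k : 0 < height k.
Proof.
apply: lt_le_trans (dyadic_ge _); rewrite mdist_gt0; apply/eqP => /x_inj e.
by have [+ _ _] := par_first k; rewrite -e ltnn.
Qed.

Lemma height_le k i : (i <= k)%N -> height k <= rho (x i) (x k.+1).
Proof. by rewrite rho_sym -ltnS; have [_ + _] := par_first k; apply. Qed.

(** If the open balls around [x k.+1] and [x l.+1] with radii [height k] and
[height l] share a point, these centers are closer than the larger radius; as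
they are at least [height l] apart, [height k] is the larger one, and rounding
improves a strict inequality to a factor 2. *)
Lemma below_gap u k l : (k < l)%N -> below k u -> below l u ->
  2 * height l <= height k.
Proof.
move=> kl uk ul; apply: dyadic_gap; rewrite -/(height l) -/(height k).
rewrite ltNge; apply/negP => hkl.
have := height_le kl; rewrite leNgt => /negP; apply.
apply: (@rho_lt _ u) => //; rewrite rho_sym; exact: lt_le_trans uk hkl.
Qed.

Lemma below_x0 k : below k (x 0%N) = false.
Proof. by apply/negbTE; rewrite -leNgt height_le. Qed.

(** Open balls of an ultrametric do not separate points closer than the radius. *)
Lemma belowE u v k : rho u v < height k -> below k u = below k v.
Proof.
move=> uv; apply/idP/idP; first by rewrite rho_sym in uv; exact: rho_lt.
exact: rho_lt.
Qed.

(** The ancestors of [x k.+1] are itself and those of its parent. Only indices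
[j] < [k] with [height j] <= [height k] need care: then [x k.+1] is not below
[x j.+1], and neither is its parent. Otherwise [x j.+1] would be within
[height k] of [x k.+1], so that [par k] <= j.+1 by minimality; equality would
make [par j] a nearest point of smaller index, and [par k] <= j would put the
parent at distance at least [height j] from [x j.+1]. *)
Lemma below_par k j : below j (x k.+1) = (j == k) || below j (x (par k)).
Proof.
have [par_k _ first_k] := par_first k.
have [->|jk] := eqVneq j k.
  by rewrite /below /rho mdistxx /=; have := height_gt0 k; rewrite /dyadic ltxx.
have [hkj|hjk] := ltP (height k) (height j); first exact: belowE.
have [kj|] := ltnP k j.
  by rewrite /below !ltNge !height_le// -ltnS (leq_trans par_k)// ltnW.
rewrite leq_eqVlt (negbTE jk)/= => {jk} jk.
have -> : below j (x k.+1) = false.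
  by apply/negbTE; rewrite -leNgt (le_trans hjk)// rho_sym height_le.
apply/esym/negbTE/negP => j_par.
have kj : rho (x k.+1) (x j.+1) <= height k.
  by apply: (@rho_le _ (x (par k))) => //; apply: ltW; apply: lt_le_trans hjk.
have : (par k <= j.+1)%N by rewrite leqNgt; apply/negP => /first_k; rewrite ltNge kj.
rewrite leq_eqVlt => /predU1P[par_j|].
  have [par_jj _ _] := par_first j.
  have : rho (x k.+1) (x (par j)) <= height k by exact: rho_le kj hjk.
  by rewrite leNgt first_k// par_j.
by rewrite ltnS => /height_le; rewrite leNgt -/(below _ _) j_par.
Qed.

Lemma coordinate_par k j :
  coordinate (x k.+1) j - coordinate (x (par k)) j = height k * (j == k)%:R.
Proof.
rewrite /coordinate below_par; have [->|] := eqVneq j k => /=.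
  rewrite /below [rho (x _) _]rho_sym ltxx subr0 mulr1//.
by rewrite subrr mulr0.
Qed.

(** Coordinates of height greater than [rho u v] agree at [u] and [v]; the other
ones are bounded by a geometric sum for each of the two points. *)
Lemma coordinate_lipschitz p u v N : 0 < p ->
  \sum_(0 <= k < N) `|coordinate u k - coordinate v k| `^ p <=
  2 * (1 - 2^-1 `^ p)^-1 * rho u v `^ p.
Proof.
move=> p0; have gs w := @geometric_sum R p height (below^~ w) p0 height_ge0
  (fun k l => @below_gap w k l) 0 N (rho u v) (dyadic_ge0 _).
apply: (@le_trans _ _
  (\sum_(0 <= k < N | below k u && (height k <= rho u v)) height k `^ p +
   \sum_(0 <= k < N | below k v && (height k <= rho u v)) height k `^ p)).
  rewrite [X in X + _]big_mkcond [X in _ + X]big_mkcond -big_split/=.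
  apply: ler_sum => k _; rewrite /coordinate.
  have [huv|/belowE->] := leP (height k) (rho u v); last first.
    by rewrite !andbF subrr normr0 powR0 ?addr0 ?gt_eqF.
  have h0 := powR_ge0 (height k) p.
  rewrite !andbT; case: below; case: below.
  - by rewrite subrr normr0 powR0 ?addr_ge0// gt_eqF.
  - by rewrite subr0 ger0_norm ?height_ge0// addr0.
  - by rewrite sub0r normrN ger0_norm ?height_ge0// add0r.
  - by rewrite subrr normr0 powR0 ?addr0// gt_eqF.
by have := gs u; have := gs v; rewrite -mulrA; lra.
Qed.

End ultrametric_tree.

(** * The isomorphism *)

Theorem theorem5p1 (R : realType) (M : metricType R) (x0 : M)
    (M_ultrametric : ultrametric M) (M_infinite : infinite_set [set: M])
    (M_separable : separable M) (p : R) (hp : 0 < p <= 1) :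
  linearly_isomorphic (lipschitz_free x0 hp) (ell hp).
Proof.
have p0 : 0 < p by case/andP: hp.
have [x [x_0 x_inj x_dense]] := dense_sequence x0 M_infinite M_separable.
have /choice[par par_first] k :=
  @first_argmin R (fun i => rho (x k.+1) (x i)) k.+1 (ltn0Sn k).
set h := height x par; have h_gt0 : forall k, 0 < h k := height_gt0 x_inj par_first.
have coord_lip := coordinate_lipschitz M_ultrametric par_first _ _ _ p0.
set C := 2 * _^-1 in coord_lip.
have C0 : 0 < C by rewrite /C mulr_gt0// invr_gt0 subr_gt0 powR_half_lt1.
have coord_x0 k : coordinate x par x0 k = 0.
  by rewrite /coordinate -x_0 (below_x0 par_first).
(* Coordinates vanish at the base point, so the Lipschitz estimate against it
   is the p-summability of the coordinates. *)
have coord_mem u : coordinate x par u \in ell_pred hp.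
  apply: (@ell_pred_bounded _ _ _ _ (C * rho u x0 `^ p)) => N.
  by apply: le_trans (coord_lip u x0 N); apply: ler_sum => k _; rewrite coord_x0 subr0.
pose f u : ell hp := EllSeq (coord_mem u).
(* The factor 2 is the distortion of rho with respect to the given metric. *)
pose K := 2 * C `^ p^-1.
have K0 : 0 < K by rewrite mulr_gt0// powR_gt0.
have f0 : f x0 = 0 by apply/val_inj/funext => k; exact: coord_x0.
have f_lip u v : pnorm (ell hp) (f u - f v) <= K * mdist u v.
  rewrite -(ler_powRE p0) ?pnorm_ge0 ?(mulr_ge0 (ltW K0)) ?mdist_ge0//.
  apply: (@le_trans _ _ (C * rho u v `^ p)).
    exact: (@ell_norm_le _ _ _ (f u - f v : ell_seq hp) _ (coord_lip u v)).
  have -> : (K * mdist u v) `^ p = C * (2 * mdist u v) `^ p.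
    rewrite /K [2 * _]mulrC -mulrA powRM ?powR_ge0 ?mulr_ge0 ?mdist_ge0//.
    by rewrite powRVK ?(ltW C0).
  rewrite ler_wpM2l ?(ltW C0)// ler_powRE ?dyadic_ge0 ?mulr_ge0 ?mdist_ge0//.
  by rewrite dyadic_le ?mdist_ge0.
have [T Tdelta T_le] := lipschitz_extension hp K0 f0 f_lip.
pose d u : molecules x0 hp := mdelta x0 u.
pose m k : molecules x0 hp := (h k)^-1 *: (d (x k.+1) - d (x (par k))).
apply: (@unit_vector_isomorphism _ _ _ _ T K m) => [//|k|k j|mu].
- rewrite pnormZ gtr0_norm ?invr_gt0// ler_pdivrMl// mulr1.
  exact: le_trans (free_norm_mdeltaB x0 hp _ _) (dyadic_ge _).
- rewrite linearZ linearB !Tdelta.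
  transitivity ((h k)^-1 * (coordinate x par (x k.+1) j - coordinate x par (x (par k)) j)).
    by [].
  by rewrite coordinate_par// mulKf// gt_eqF.
- apply: (closed_span_molecules x_dense) => n.
  (* The edges on the branch from the root to x n add up to delta (x n). *)
  elim/ltn_ind: n => -[_|n IHn].
    by rewrite x_0 [X in fin_span _ X]mdelta_x0; exact: fin_span0.
  rewrite [X in fin_span _ X](_ : _ = h n *: m n + d (x (par n))).
    by apply: fin_span_linear; [exact: fin_span_gen|apply: IHn; case: (par_first n)].
  by rewrite scalerA divff ?gt_eqF// scale1r subrK.
Qed.
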